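(* Let $\alpha\in[0,1]$. Let $G_1$ be a $t_1$-regular graph of order $n_1$ and size $m_1$, and let $G_2=K_{a,b}$ be the complete bipartite graph of order $n_2=a+b$. (a) When $t_1=1$, the $A_\alpha$-spectrum of $G_1\underline\vee_T G_2$ comprises: (i) one simple eigenvalue $3\alpha-1$; (ii) one eigenvalue $\alpha(1+a)$ with multiplicity $b-1$; (iii) one eigenvalue $\alpha(1+b)$ with multiplicity $a-1$; and (iv) four eigenvalues obtained by solving the equation $$\begin{aligned}&\big( \nu^2 -\alpha (3 + n_2)\nu + \alpha^2n_2 -\alpha n_2+6\alpha -2 \big) \big( \nu^2 -\alpha(2 +n_2)\nu + \alpha^2(1+n_2) +2\alpha ab -ab \big)\\ &-(1-\alpha)^2(\nu-\alpha -1) \big( (\nu-\alpha)n_2 -\alpha n_2^2 + 2ab \big)=0.\end{aligned}$$ (b) When $t_1\ge2$, the $A_\alpha$-spectrum of $G_1\underline\vee_T G_2$ comprises: (i) one eigenvalue $\alpha(2t_1+2+n_2)-2$ with multiplicity $m_1-n_1$; (ii) one eigenvalue $\alpha(m_1+a)$ with multiplicity $b-1$; (iii) one eigenvalue $\alpha(m_1+b)$ with multiplicity $a-1$; (iv) the eigenvalues obtained by solving, for each $i=2,3,\ldots,n_1$, the equation $$\begin{aligned}&\nu^2 -\big( \alpha(t_1 +n_2 +2)+t_1 -2 +2\lambda_i(A_{\alpha}(G_1))\big)\nu - t_1 (1-\alpha)(1-3\alpha)\\ &+\big(\alpha t_1 +\lambda_i(A_{\alpha}(G_1))\big)\big(t_1-3+3\alpha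 +\alpha n_2 + \lambda_i(A_{\alpha}(G_1))\big)=0;\end{aligned}$$ and (v) four eigenvalues obtained by solving the equation $$\begin{aligned}&\big( \nu^2 -(\alpha( t_1 + n_2+2) +3t_1 -2)\nu -4t_1 +2t_1^2 +4\alpha t_1 +\alpha t_1 n_2 + 2\alpha t_1^2 + \alpha^2 t_1 n_2 \big)\\ &\times \big( \nu^2 -\alpha(2 m_1 + n_2)\nu + \alpha^2m_1(m_1 + n_2) +2\alpha ab -ab \big)\\ &-\tfrac{1}{2}t_1n_1(1-\alpha)^2(\nu-t_1-\alpha t_1)\big((\nu-\alpha m_1)n_2 -\alpha n_2^2 +2ab \big)=0.\end{aligned}$$
   Context: All graphs are undirected and simple. For a graph $G$ with adjacency matrix $A(G)$ and diagonal degree matrix $D(G)$, put $A_\alpha(G)=\alpha D(G)+(1-\alpha)A(G)$. The $A_\alpha$-spectrum of $G$ is the multiset of eigenvalues of $A_\alpha(G)$. Eigenvalues of a symmetric $n\times n$ matrix $M$ are ordered $\lambda_1(M)\ge\cdots\ge\lambda_n(M)$. The order of a graph is its number of vertices and its size is its number of edges. $K_{a,b}$ is the complete bipartite graph with parts of sizes $a$ and $b$. The total graph $T(G)$ is obtained from $G$ (keeping all its vertices and edges) by adding one new vertex for every edge of $G$, making each new vertex adjacent to the two end vertices of the corresponding edge, and making two new vertices adjacent whenever their corresponding (distinct) edges share an endpoint in $G$. The $T$-edge join $G_1\underline\vee_T G_2$ is obtained from the disjoint union of $T(G_1)$ and $G_2$ by joining each newly added vertex of $T(G_1)$ to every vertex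 of $G_2$.
   Formalization: In (a), G_1 is assumed connected (so K_2; otherwise the count of eigenvalues fails), and the first factor of (iv), false by a trace check, is corrected to ν²−(α(3+n_2)+1)ν+α²n_2+αn_2+6α−2; ''simple'' means listed once. *)

(* Defs.v *)
From HB Require Import structures.
From mathcomp Require Import all_boot all_order all_algebra.
From mathcomp Require Import polyrcf.

Set Implicit Arguments.
Unset Strict Implicit.
Unset Printing Implicit Defensive.

Import Order.TTheory GRing.Theory Num.Theory.

Record sgraph := SGraph {
  vertex :> finType;
  adj : rel vertex;
  adj_sym : symmetric adj;
  adj_irrefl : irreflexive adj }.

Section Graphs.

Definition degree (G : sgraph) (x : G) : nat := #|[set y | adj x y]|.

Definition regular (G : sgraph) (t : nat) : Prop := forall x : G, degree x = t.

Definition connected (G : sgraph) : Prop :=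
  forall x y : G, connect (@adj G) x y.

Definition edges (G : sgraph) : {set {set G}} :=
  [set [set p.1; p.2] | p : G * G & adj p.1 p.2].

Definition edge (G : sgraph) : finType := {A : {set G} | A \in edges G}.

Definition total_adj (G : sgraph) : rel (G + edge G) := fun u v =>
  match u, v with
  | inl x, inl y => adj x y
  | inl x, inr A => x \in val A
  | inr A, inl x => x \in val A
  | inr A, inr B => (A != B) && (val A :&: val B != set0)
  end.

Fact total_adj_sym (G : sgraph) : symmetric (@total_adj G).
Proof.
by move=> [x|A] [y|B] //=; [exact: adj_sym | rewrite eq_sym setIC].
Qed.

Fact total_adj_irrefl (G : sgraph) : irreflexive (@total_adj G).
Proof. by move=> [x|A] /=; [exact: adj_irrefl | rewrite eqxx]. Qed.

Definition total_graph (G : sgraph) : sgraph :=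
  SGraph (@total_adj_sym G) (@total_adj_irrefl G).

Definition T_edge_join_adj (G1 G2 : sgraph) : rel (total_graph G1 + G2) :=
  fun u v =>
  match u, v with
  | inl x, inl y => adj x y
  | inr x, inr y => adj x y
  | inl x, inr _ | inr _, inl x => if x is inr _ then true else false
  end.

Fact T_edge_join_adj_sym (G1 G2 : sgraph) : symmetric (@T_edge_join_adj G1 G2).
Proof.
move=> [u|x] [v|y].
- exact: (@adj_sym (total_graph G1) u v).
- by [].
- by [].
- exact: (@adj_sym G2 x y).
Qed.

Fact T_edge_join_adj_irrefl (G1 G2 : sgraph) :
  irreflexive (@T_edge_join_adj G1 G2).
Proof.
move=> [u|x].
- exact: (@adj_irrefl (total_graph G1) u).
- exact: (@adj_irrefl G2 x).
Qed.

Definition T_edge_join (G1 G2 : sgraph) : sgraph :=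
  SGraph (@T_edge_join_adj_sym G1 G2) (@T_edge_join_adj_irrefl G1 G2).

Definition complete_bipartite_adj (a b : nat) : rel ('I_a + 'I_b) :=
  fun u v =>
  match u, v with
  | inl _, inr _ | inr _, inl _ => true
  | _, _ => false
  end.

Fact complete_bipartite_adj_sym a b : symmetric (@complete_bipartite_adj a b).
Proof. by move=> [x|x] [y|y]. Qed.

Fact complete_bipartite_adj_irrefl a b :
  irreflexive (@complete_bipartite_adj a b).
Proof. by move=> [x|x]. Qed.

Definition complete_bipartite (a b : nat) : sgraph :=
  SGraph (@complete_bipartite_adj_sym a b) (@complete_bipartite_adj_irrefl a b).

End Graphs.

Local Open Scope ring_scope.

Section Spectra.
Variable R : rcfType.

Definition adjacency_mx (G : sgraph) : 'M[R]_#|G| :=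
  \matrix_(i, j) (adj (enum_val i) (enum_val j))%:R.

Definition degree_mx (G : sgraph) : 'M[R]_#|G| :=
  diag_mx (\row_i (degree (enum_val i))%:R).

Definition A_alpha (alpha : R) (G : sgraph) : 'M[R]_#|G| :=
  alpha *: degree_mx G + (1 - alpha) *: adjacency_mx G.

(* The solutions of p(x) = 0 in R, each listed with its multiplicity and in   *)
(* nonincreasing order; [::] when p = 0.                                      *)
Definition solutions (p : {poly R}) : seq R :=
  sort >=%R (flatten [seq nseq (mup x p) x | x <- rootsR p]).

(* For a symmetric matrix all the roots of the characteristic polynomial are  *)
(* in R, and algebraic and geometric multiplicities agree, so no eigenvalue   *)
(* is lost here.                                                              *)
Definition spectrum n (M : 'M[R]_n) : seq R := solutions (char_poly M).

(* lambda_i(M), with i counted from 1. *)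
Definition lambda n (i : nat) (M : 'M[R]_n) : R := nth 0 (spectrum M) i.-1.

(* 'X plays the role of the unknown nu. The integer parameters are passed     *)
(* already cast to R.                                                         *)

(* The first factor is that of [quartic_regular] at t1 = 1. The formula in    *)
(* the literature, 'X^2 - alpha (3 + n2) 'X + alpha^2 n2 - alpha n2 +         *)
(* 6 alpha - 2, makes the eigenvalues of the join add up to tr A_alpha - 1,   *)
(* so it cannot be right: the linear coefficient lacks a -1 and the term      *)
(* alpha n2 has the wrong sign.                                               *)
Definition quartic_K2 (alpha a b : R) : {poly R} :=
  let n2 := a + b in
  ('X^2 - (alpha * (3 + n2) + 1) *: 'X
     + (alpha ^+ 2 * n2 + alpha * n2 + 6 * alpha - 2)%:P)
  * ('X^2 - (alpha * (2 + n2)) *: 'X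
     + (alpha ^+ 2 * (1 + n2) + 2 * alpha * a * b - a * b)%:P)
  - (1 - alpha) ^+ 2 *: (('X - (alpha + 1)%:P)
     * (n2 *: ('X - alpha%:P) - (alpha * n2 ^+ 2)%:P + (2 * a * b)%:P)).

Definition quadratic_regular (alpha t1 n2 l : R) : {poly R} :=
  'X^2 - (alpha * (t1 + n2 + 2) + t1 - 2 + 2 * l) *: 'X
  - (t1 * (1 - alpha) * (1 - 3 * alpha))%:P
  + ((alpha * t1 + l) * (t1 - 3 + 3 * alpha + alpha * n2 + l))%:P.

Definition quartic_regular (alpha t1 n1 m1 a b : R) : {poly R} :=
  let n2 := a + b in
  ('X^2 - (alpha * (t1 + n2 + 2) + 3 * t1 - 2) *: 'X
     + (- (4 * t1) + 2 * t1 ^+ 2 + 4 * alpha * t1 + alpha * t1 * n2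
        + 2 * alpha * t1 ^+ 2 + alpha ^+ 2 * t1 * n2)%:P)
  * ('X^2 - (alpha * (2 * m1 + n2)) *: 'X
     + (alpha ^+ 2 * m1 * (m1 + n2) + 2 * alpha * a * b - a * b)%:P)
  - (2^-1 * t1 * n1 * (1 - alpha) ^+ 2) *: (('X - (t1 + alpha * t1)%:P)
     * (n2 *: ('X - (alpha * m1)%:P) - (alpha * n2 ^+ 2)%:P + (2 * a * b)%:P)).

End Spectra.

(* Main.v *)
Require Import Defs.
From mathcomp Require Import all_boot all_order all_algebra.
From mathcomp Require Import perm polyrcf complex.
From mathcomp Require Import ring zify.
Import Order.TTheory GRing.Theory Num.Theory.
Local Open Scope ring_scope.
Set Implicit Arguments.
Unset Strict Implicit.
Unset Printing Implicit Defensive.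

(* Let L = A_alpha(G1), n and m the order and size of G1, and B its incidence
   matrix, so that B B^T = A(G1) + t and B^T B = A(line graph) + 2. Then
   nu - A_alpha(join) is a block diagonal matrix with scalar blocks, minus a
   product U V in which U consists of 1, B^T and the two all-one columns of the
   parts of K_{a,b}; the identity det(1 - X Y) = det(1 - Y X) replaces its
   determinant by that of a matrix of order 2 n + 2 whose blocks are polynomials
   in L and all-one matrices. Two Schur complements leave det(q(L) - k J), where
   q(lambda_i) is the quadratic of the statement and J the all-one matrix. As J
   only perturbs the eigenvalue t of L, this is the product of the q(lambda_i),
   i >= 2, and the quartic. The result is an identity between characteristic
   polynomials, from which the spectrum is read off by unique factorization.
   Symmetric matrices have split characteristic polynomials, so every factor
   has as many solutions as its degree. *)

(** * Polynomials and spectra *)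

Section Polynomials.
Variable R : rcfType.
Implicit Types (p q : {poly R}) (s : seq R).

(** In characteristic 0, [(p - q) * bad] would vanish at more natural numbers than its degree
    allows. Determinant identities can thus be checked only where the matrices to be inverted are
    invertible. *)
Lemma poly_eq_off_roots (bad p q : {poly R}) :
  bad != 0 -> (forall x, ~~ root bad x -> p.[x] = q.[x]) -> p = q.
Proof.
move=> bad0 eqpq; apply/eqP; rewrite -subr_eq0; apply/negP => /negP d0.
have pb0 : (p - q) * bad != 0 by rewrite mulf_neq0.
pose s : seq R := [seq i%:R | i <- iota 0 (size ((p - q) * bad))].
have /(max_poly_roots pb0) : all (root ((p - q) * bad)) s.
  apply/allP => x _; rewrite rootM orbC.
  by case: (boolP (root bad x)) => // /eqpq e; rewrite rootE !hornerE e subrr.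
rewrite size_map size_iota ltnn => absurd; suff /absurd : uniq s by [].
by rewrite map_inj_uniq ?iota_uniq // => i j /eqP; rewrite eqr_nat => /eqP.
Qed.

Lemma count_mem_solutions p x : p != 0 -> count_mem x (solutions p) = mup x p.
Proof.
move=> p0; rewrite /solutions count_sort count_flatten -map_comp.
have -> : sumn [seq (count_mem x \o (fun y => nseq (mup y p) y)) y | y <- rootsR p]
    = (count_mem x (rootsR p) * mup x p)%N.
  elim: (rootsR p) => //= y r ->; rewrite count_nseq /= mulnDl.
  by case: eqP => [->|].
rewrite count_uniq_mem ?uniq_roots // -roots_on_rootsR //=.
by case: (boolP (root p x)) => [|/mupNroot ->]; rewrite ?mul1n ?muln0.
Qed.

Lemma solutions_prod s : perm_eq (solutions (\prod_(x <- s) ('X - x%:P))) s.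
Proof.
apply/allP => x _; apply/eqP; rewrite /= count_mem_solutions ?mu_prod_XsubC //.
exact/monic_neq0/monic_prod_XsubC.
Qed.

(** By unique factorization a monic divisor of a product of linear factors is a subproduct. This is
    how a factor of a split polynomial is shown to have all its roots in [R]. *)
Lemma monic_dvd_split p s :
  p \is monic -> p %| \prod_(x <- s) ('X - x%:P) ->
  p = \prod_(x <- solutions p) ('X - x%:P).
Proof.
move=> pm /dvdp_prod_XsubC [msk].
rewrite eqp_monic ?monic_prod_XsubC // => /eqP ->.
by apply/esym/perm_big; apply: solutions_prod.
Qed.

Lemma size_solutions p :
  p = \prod_(x <- solutions p) ('X - x%:P) -> size (solutions p) = (size p).-1.
Proof. by move=> {2}->; rewrite size_prod_XsubC. Qed.

End Polynomials.

Section SymmetricSpectrum.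
Variable R : rcfType.

Lemma horner_char_poly n (M : 'M[R]_n) x : (char_poly M).[x] = \det (x%:M - M).
Proof.
rewrite /char_poly -[_.[x]]/(horner_eval x _) -det_map_mx; congr (\det _).
by apply/matrixP => i j; rewrite !mxE /= /horner_eval !hornerE hornerMn hornerX.
Qed.

Lemma quadratic_conj_diag (F : fieldType) n (M P : 'M[F]_n) d c2 c1 c0 :
  P \in unitmx -> M = invmx P *m diag_mx d *m P ->
  c2 *: (M *m M) + c1 *: M + c0%:M
    = invmx P *m diag_mx (\row_i (c2 * d 0 i ^+ 2 + c1 * d 0 i + c0)) *m P.
Proof.
move=> Pu eM; have -> : diag_mx (\row_i (c2 * d 0 i ^+ 2 + c1 * d 0 i + c0))
    = c2 *: (diag_mx d *m diag_mx d) + c1 *: diag_mx d + c0%:M.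
  apply/matrixP => i j; rewrite mulmx_diag !mxE.
  by case: eqP => [->|]; rewrite ?mulr1n ?mulr0n ?mulr0 ?addr0.
rewrite !mulmxDr !mulmxDl -!scalemxAr -!scalemxAl.
rewrite -[X in _ = _ + X]mulmxA -scalar_mxC [X in _ = _ + X]mulmxA mulVmx // mul1mx.
by rewrite {1 2}eM -!mulmxA (mulKVmx Pu) !mulmxA -eM.
Qed.

(* Diagonalising over R[i] evaluates at once the determinant of every quadratic
   polynomial in M; the choice (0, -1, x) gives the characteristic polynomial. *)
Lemma sym_det_quadratic n (M : 'M[R]_n) : M^T = M ->
  exists s : seq R, forall c2 c1 c0,
    \det (c2 *: (M *m M) + c1 *: M + c0%:M)
      = \prod_(x <- s) (c2 * x ^+ 2 + c1 * x + c0).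
Proof.
move=> symM; pose f : {rmorphism R -> R[i]} := real_complex R; pose MC : 'M[R[i]]_n := map_mx f M.
have MCreal : MC \is a mxOver Num.real.
  by apply/mxOverP => i j; rewrite mxE; apply/complex_realP; exists (M i j).
have MCsym : MC \is symmetricmx.
  apply/is_hermitianmxP; rewrite expr0 scale1r map_mx_id //.
  by apply/matrixP => i j; rewrite !mxE -{1}symM mxE.
have MCherm := realsym_hermsym MCsym MCreal.
have /orthomx_spectralP eM := hermitian_normalmx MCherm.
have /mxOverP dreal := hermitian_spectral_diag_real MCherm.
set P := spectralmx MC in eM; set d := spectral_diag MC in eM dreal.
have Pu : P \in unitmx by apply: spectral_unit.
exists [seq complex.Re (d 0 i) | i <- enum 'I_n] => c2 c1 c0.
apply: (@complexI R); rewrite -[LHS]/(f _) -[RHS]/(f _) -det_map_mx.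
have -> : map_mx f (c2 *: (M *m M) + c1 *: M + c0%:M)
    = invmx P *m (diag_mx (\row_i (f c2 * d 0 i ^+ 2 + f c1 * d 0 i + f c0))) *m P.
  rewrite !map_mxD !map_mxZ map_mxM map_scalar_mx -/MC.
  exact: quadratic_conj_diag.
rewrite !det_mulmx det_inv mulrAC mulVr ?mul1r -?unitmxE // det_diag.
rewrite big_map big_enum rmorph_prod; apply: eq_bigr => i _.
by rewrite mxE !rmorphD !rmorphM /= RRe_real ?expr2.
Qed.

(** The list produced by the diagonalization is identified with [spectrum M] through the
    characteristic polynomial. *)
Lemma sym_spectrum n (M : 'M[R]_n) : M^T = M ->
  char_poly M = \prod_(x <- spectrum M) ('X - x%:P) /\
  forall c2 c1 c0, \det (c2 *: (M *m M) + c1 *: M + c0%:M)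
      = \prod_(x <- spectrum M) (c2 * x ^+ 2 + c1 * x + c0).
Proof.
move=> /sym_det_quadratic[s Ms].
have chM : char_poly M = \prod_(x <- s) ('X - x%:P).
  apply: (poly_eq_off_roots (oner_neq0 _)) => x _.
  have := Ms 0 (-1) x; rewrite scale0r add0r scaleN1r addrC => e.
  rewrite horner_char_poly e horner_prod; apply: eq_bigr => y _.
  by rewrite !hornerE; ring.
have perms : perm_eq (spectrum M) s by rewrite /spectrum chM solutions_prod.
by split=> [|c2 c1 c0]; rewrite ?chM ?Ms; apply/esym/perm_big.
Qed.

End SymmetricSpectrum.

(** * Determinants *)

Section Determinants.
Variable F : fieldType.

Lemma det_Schur_dr m n (A : 'M[F]_m) (B : 'M_(m, n)) C (D : 'M[F]_n) :
  D \in unitmx ->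
  \det (block_mx A B C D) = \det D * \det (A - B *m invmx D *m C).
Proof.
move=> Du; have -> : block_mx A B C D =
    block_mx (A - B *m invmx D *m C) (B *m invmx D) 0 1%:M *m block_mx 1%:M 0 C D.
  rewrite mulmx_block !mulmx1 !mul0mx !mulmx0 !mul1mx !add0r.
  by rewrite subrK mulmxKV.
by rewrite det_mulmx det_ublock det_lblock !det1 mulr1 mul1r mulrC.
Qed.

Lemma det_Schur_ul m n (A : 'M[F]_m) (B : 'M_(m, n)) C (D : 'M[F]_n) :
  A \in unitmx ->
  \det (block_mx A B C D) = \det A * \det (D - C *m invmx A *m B).
Proof.
move=> Au; have -> : block_mx A B C D =
    block_mx 1%:M 0 (C *m invmx A) 1%:M *m block_mx A B 0 (D - C *m invmx A *m B).
  rewrite mulmx_block !mul0mx !mulmx0 !mul1mx !addr0.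
  by rewrite mulmxKV // addrC subrK.
by rewrite det_mulmx det_ublock det_lblock !det1 mulr1 mul1r.
Qed.

(** Both sides are Schur complements of the block matrix with rows (1, A) and (B, 1). *)
Lemma det_one_sub_mulC m n (A : 'M[F]_(m, n)) (B : 'M_(n, m)) :
  \det (1%:M - A *m B) = \det (1%:M - B *m A).
Proof.
have := det_Schur_dr (1%:M : 'M_m) A B (unitmx1 F n).
by rewrite det_Schur_ul ?unitmx1 // !invmx1 !mulmx1 !det1 !mul1r => ->.
Qed.

(** The intertwining relation gives [U = D *m X = X *m D'], so [D] and [D'] factor out and
    [det_one_sub_mulC] applies to what remains. *)
Lemma det_intertwined m n (D : 'M[F]_m) (D' : 'M[F]_n) (U : 'M_(m, n)) V :
  D \in unitmx -> D' \in unitmx -> D *m U = U *m D' ->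
  \det (D - U *m V) * \det D' = \det D * \det (D' - V *m U).
Proof.
move=> Du Du' DU; pose X := U *m invmx D'.
have -> : D - U *m V = D *m (1%:M - X *m V).
  by rewrite mulmxBr mulmx1 /X !mulmxA DU mulmxK.
have -> : D' - V *m U = (1%:M - V *m X) *m D'.
  by rewrite mulmxBl mul1mx /X mulmxA mulmxKV.
by rewrite !det_mulmx (det_one_sub_mulC X) mulrA.
Qed.

(** A rank-one perturbation: the inverse of [q] scales the all-one vector by [x^-1], and after
    factoring out [q] the determinant is that of a matrix of order 1. *)
Lemma det_sub_const n (q : 'M[F]_n) (x k : F) : q \in unitmx -> x != 0 ->
  q *m const_mx 1 = x *: const_mx 1 :> 'cV_n ->
  \det (q - k *: const_mx 1) * x = \det q * (x - k * n%:R).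
Proof.
move=> qu x0 q1.
have -> : q - k *: const_mx 1 = q *m (1%:M - ((k / x) *: const_mx 1 : 'cV_n) *m (const_mx 1 : 'rV_n)).
  rewrite mulmxBr mulmx1 mulmxA -scalemxAr q1 scalerA divfK // -scalemxAl.
  by congr (_ - _ *: _); apply/matrixP => i j; rewrite !mxE big_ord1 !mxE mulr1.
rewrite det_mulmx det_one_sub_mulC det_mx11 !mxE -mulrA; congr (_ * _).
under eq_bigr do rewrite !mxE mul1r mulr1.
rewrite sumr_const card_ord -mulr_natr mulr1n mul1r -mulr_natr; field => //.
Qed.

End Determinants.

(** * Matrices indexed by finite types *)

Section FinTypeMatrix.
Variable R : comPzRingType.

Definition fun_mx (S T : finType) (f : S -> T -> R) : 'M[R]_(#|S|, #|T|) :=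
  \matrix_(i, j) f (enum_val i) (enum_val j).

Lemma mul_fun_mx (S T U : finType) (f : S -> T -> R) (g : T -> U -> R) :
  fun_mx f *m fun_mx g = fun_mx (fun x z => \sum_y f x y * g y z).
Proof.
apply/matrixP => i j; rewrite !mxE.
rewrite (reindex (@enum_rank T)) /=; last first.
  by exists enum_val => ? _; rewrite ?enum_rankK ?enum_valK.
by apply: eq_bigr => y _; rewrite !mxE enum_rankK.
Qed.

(** One permutation acts on both rows and columns, so its two signs cancel. *)
Lemma det_reindex m n (M : 'M[R]_m) (N : 'M[R]_n) (h : 'I_m -> 'I_n) :
  bijective h -> (forall i j, M i j = N (h i) (h j)) -> \det M = \det N.
Proof.
move=> bh; have /esym := bij_eq_card bh; rewrite !card_ord => emn.
move: bh; subst n => bh MN; have hi := bij_inj bh.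
have -> : M = row_perm (perm hi) (col_perm (perm hi) N).
  by apply/matrixP => i j; rewrite !mxE !permE MN.
rewrite row_permE col_permE !det_mulmx !det_perm odd_permV.
by rewrite mulrC -mulrA -signr_addb addbb mulr1.
Qed.

(** Lists [S] before [T], in the index order of [block_mx], so that a matrix over a sum type splits
    into its blocks. *)
Definition ord_sum (S T : Type) m n (h : 'I_m -> S) (k : 'I_n -> T)
    (i : 'I_(m + n)) : S + T :=
  match split i with inl j => inl (h j) | inr j => inr (k j) end.

Lemma ord_sum_bij (S T : Type) m n (h : 'I_m -> S) (k : 'I_n -> T) :
  bijective h -> bijective k -> bijective (ord_sum h k).
Proof.
case=> h' hK h'K [k' kK k'K].
exists (fun z => match z with inl y => lshift _ (h' y) | inr y => rshift _ (k' y) end).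
  by move=> i; rewrite /ord_sum -[RHS]splitK; case: (split i) => j; rewrite ?hK ?kK.
by case=> z; rewrite /ord_sum ?(unsplitK (inl _)) ?(unsplitK (inr _)) ?h'K ?k'K.
Qed.

Lemma block_ord_sum (S T S' T' : Type) m n p q (h : 'I_m -> S) (k : 'I_n -> T)
    (h' : 'I_p -> S') (k' : 'I_q -> T') (f : S + T -> S' + T' -> R) :
  \matrix_(i, j) f (ord_sum h k i) (ord_sum h' k' j) = block_mx
    (\matrix_(i, j) f (inl (h i)) (inl (h' j)))
    (\matrix_(i, j) f (inl (h i)) (inr (k' j)))
    (\matrix_(i, j) f (inr (k i)) (inl (h' j)))
    (\matrix_(i, j) f (inr (k i)) (inr (k' j))).
Proof.
apply/matrixP => i j; rewrite [LHS]mxE -{2}(splitK i) -{2}(splitK j) /ord_sum.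
by case: (split i) => i'; case: (split j) => j' /=;
  rewrite ?block_mxEul ?block_mxEur ?block_mxEdl ?block_mxEdr mxE.
Qed.

Lemma det_fun_mx (T : finType) n (h : 'I_n -> T) (f : T -> T -> R) :
  bijective h -> \det (fun_mx f) = \det (\matrix_(i, j) f (h i) (h j)).
Proof.
move=> bh; apply/esym/(det_reindex (h := enum_rank \o h)).
  by apply: bij_comp => //; exists enum_val => ?; rewrite ?enum_rankK ?enum_valK.
by move=> i j; rewrite !mxE /= !enum_rankK.
Qed.

End FinTypeMatrix.

(** * The determinant of the block matrix of the join *)

Section BlockDeterminant.
Variables (F : numFieldType) (n m a b : nat).
Variables (L : 'M[F]_n) (B : 'M[F]_(n, m)) (alpha t nu Y x y : F).
Let g := 1 - alpha.
(* B B^T = A(G1) + t, so that (1 - alpha) B B^T is affine in L even for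
   alpha = 1, where L no longer determines A(G1). *)
Let w := (g - alpha) * t.
Hypothesis BBT : g *: (B *m B^T) = L + w%:M.
Hypothesis L1 : L *m (const_mx 1 : 'cV_n) = t *: const_mx 1.
Hypothesis B1 : B *m (const_mx 1 : 'cV_m) = t *: const_mx 1.
Hypothesis BT1 : B^T *m (const_mx 1 : 'cV_n) = 2 *: const_mx 1.

Let S : 'M[F]_n := nu%:M - (alpha * t)%:M - L.
(** [delta] is the determinant of the quotient of the K_{a,b} block by its two parts. When that
    block is invertible, [sigma / delta] is the sum of the entries of its inverse (its coronal). *)
Let delta := x * y - g ^+ 2 * a%:R * b%:R.
Let sigma := a%:R * y + b%:R * x + 2 * g * a%:R * b%:R.

(* With L = A_alpha(G1), B the vertex-edge incidence matrix, and Y, x, y as in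
   [det_join_A_alpha] below, this is nu - A_alpha of the join. *)
Definition join_pencil : 'M[F]_((n + m) + (a + b)) :=
  block_mx (block_mx S (- g *: B) (- g *: B^T) (Y%:M - g *: (B^T *m B)))
    (block_mx 0 0 (const_mx (- g)) (const_mx (- g)))
    (block_mx 0 (const_mx (- g)) 0 (const_mx (- g)))
    (block_mx x%:M (const_mx (- g)) (const_mx (- g)) y%:M).

(** The coefficients of L and 1 in the expansion of S (Y - w - L) - g (L + w), the determinant over
    polynomials in L of the upper left block of [reduced_pencil]. *)
Definition quad_c1 := - (nu - alpha * t) - (Y - w) - g.
Definition quad_c0 := (nu - alpha * t) * (Y - w) - g * w.

Definition reduced_pencil : 'M[F]_((n + n) + (1 + 1)) :=
  block_mx (block_mx S (- (L + w%:M)) (- g%:M) (Y%:M - (L + w%:M)))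
    (block_mx 0 0 (const_mx (- (g / 2 * a%:R))) (const_mx (- (g / 2 * b%:R))))
    (block_mx 0 (const_mx (- (g * t))) 0 (const_mx (- (g * t))))
    (block_mx x%:M (- (g * b%:R)%:M) (- (g * a%:R)%:M) y%:M).

Lemma mul_const_mx p q r (u v : F) :
  (const_mx u : 'M_(p, q)) *m (const_mx v : 'M_(q, r)) = const_mx (u * v * q%:R).
Proof.
apply/matrixP => i j; rewrite !mxE; under eq_bigr do rewrite !mxE.
by rewrite sumr_const card_ord mulr_natr.
Qed.

Lemma opp_const_mx p q (u : F) : - const_mx u = const_mx (- u) :> 'M_(p, q).
Proof. by apply/matrixP => i j; rewrite !mxE. Qed.

Lemma const_mx11 (u : F) : const_mx u = u%:M :> 'M_1.
Proof. by apply/matrixP => i j; rewrite !mxE !ord1 mulr1n. Qed.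

Lemma const_mxZ p q (u : F) : const_mx u = u *: const_mx 1 :> 'M_(p, q).
Proof. by apply/matrixP => i j; rewrite !mxE mulr1. Qed.

Lemma BT_const p u : B^T *m const_mx u = const_mx (2 * u) :> 'M_(m, p).
Proof.
have -> : const_mx u = (const_mx 1 : 'cV_n) *m (const_mx u : 'rV_p).
  by rewrite mul_const_mx mul1r mulr1.
by rewrite mulmxA BT1 -const_mxZ mul_const_mx mulr1.
Qed.

Lemma const_BT u : (const_mx u : 'rV_m) *m B^T = const_mx (t * u).
Proof.
rewrite -[LHS]trmxK trmx_mul trmxK trmx_const const_mxZ -scalemxAr B1.
by rewrite scalerA -const_mxZ trmx_const mulrC.
Qed.

(* The blocks of [join_pencil] depend on G only through the maps 1, B^T, 1_a and
   1_b, so [det_intertwined] shrinks the n + m + a + b rows to n + n + 1 + 1. *)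
Lemma det_join_pencil : nu != 0 -> Y != 0 -> x != 0 -> y != 0 ->
  \det join_pencil * (Y ^+ n * x * y) = Y ^+ m * x ^+ a * y ^+ b * \det reduced_pencil.
Proof.
move=> nu0 Y0 x0 y0.
pose D : 'M[F]_((n + m) + (a + b)) :=
  block_mx (block_mx nu%:M 0 0 Y%:M) 0 0 (block_mx x%:M 0 0 y%:M).
pose D' : 'M[F]_((n + n) + (1 + 1)) :=
  block_mx (block_mx nu%:M 0 0 Y%:M) 0 0 (block_mx x%:M 0 0 y%:M).
pose U : 'M[F]_((n + m) + (a + b), (n + n) + (1 + 1)) :=
  block_mx (block_mx 1%:M 0 0 B^T) 0 0 (block_mx (const_mx 1) 0 0 (const_mx 1)).
(* The entries [g / 2] become [g] under [B^T], which doubles constants since an edge has two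
   ends. *)
pose V : 'M[F]_((n + n) + (1 + 1), (n + m) + (a + b)) :=
  block_mx (block_mx ((alpha * t)%:M + L) (g *: B) g%:M (g *: B))
    (block_mx 0 0 (const_mx (g / 2)) (const_mx (g / 2)))
    (block_mx 0 (const_mx g) 0 (const_mx g))
    (block_mx 0 (const_mx g) (const_mx g) 0).
have detD : \det D = nu ^+ n * Y ^+ m * (x ^+ a * y ^+ b).
  by rewrite /D !det_ublock !det_scalar.
have detD' : \det D' = nu ^+ n * Y ^+ n * (x * y).
  by rewrite /D' !det_ublock !det_scalar !expr1.
have Du : D \in unitmx by rewrite unitmxE detD unitfE !mulf_neq0 ?expf_neq0.
have Du' : D' \in unitmx by rewrite unitmxE detD' unitfE !mulf_neq0 ?expf_neq0.
have DU : D *m U = U *m D'.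
  rewrite /D /U /D' !mulmx_block !(mulmx0, mul0mx, addr0, add0r, mulmx1, mul1mx).
  by rewrite !mul_scalar_mx !mul_mx_scalar.
have DUV : D - U *m V = join_pencil.
  rewrite /D /U /V /join_pencil !mulmx_block !(mulmx0, mul0mx, addr0, add0r, mul1mx).
  rewrite !opp_block_mx !add_block_mx !(oppr0, addr0, add0r).
  rewrite !BT_const !mul_const_mx mul_mx_scalar -scalemxAr !opp_const_mx.
  by rewrite !mulr1 !mul1r [2 * _]mulrC divfK ?pnatr_eq0 // !scaleNr opprD addrA /S.
have DVU : D' - V *m U = reduced_pencil.
  rewrite /D' /U /V /reduced_pencil !mulmx_block !(mulmx0, mul0mx, addr0, add0r, mulmx1).
  rewrite !opp_block_mx !add_block_mx !(oppr0, addr0, add0r).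
  rewrite !const_BT !mul_const_mx -scalemxAl BBT -!const_mx11 !opp_const_mx.
  by rewrite opprD addrA !mulr1 (mulrC t) /S.
have := det_intertwined V Du Du' DU; rewrite DUV DVU detD detD' => e.
by apply: (mulfI (expf_neq0 n nu0)); move: e; move: (\det _) (\det _) => d1 d2 e; ring: e.
Qed.

(** Eliminating the two rows of K_{a,b} changes the rest only by a multiple of the all-one matrix J.
    Eliminating S then multiplies J by S, that is by nu - alpha t - t, and [det_sub_const]
    concludes. *)
Lemma det_reduced_pencil :
  let q z := z ^+ 2 + quad_c1 * z + quad_c0 in
  let qL := L *m L + quad_c1 *: L + quad_c0%:M in
  x != 0 -> delta != 0 -> S \in unitmx -> qL \in unitmx -> q t != 0 ->
  \det reduced_pencil * q t = \det qL *
    (q t * delta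
      - 2^-1 * t * n%:R * g ^+ 2 * (nu - (t + alpha * t)) * sigma).
Proof.
move=> q qL x0 d0 Su qLu qt0; pose Q : 'M[F]_(1 + 1) :=
  block_mx x%:M (- (g * b%:R)%:M) (- (g * a%:R)%:M) y%:M.
pose Z : 'M[F]_(1 + 1) := delta^-1 *:
  block_mx y%:M (g * b%:R)%:M (g * a%:R)%:M x%:M.
have QZ : Q *m Z = 1%:M.
  rewrite /Q /Z -scalemxAr mulmx_block -!raddfN /= -!scalar_mxM -!raddfD /=.
  rewrite scale_block_mx !scale_scalar_mx.
  have [-> -> -> ->] : [/\ delta^-1 * (x * y + - (g * b%:R) * (g * a%:R)) = 1,
      delta^-1 * (x * (g * b%:R) + - (g * b%:R) * x) = 0,
      delta^-1 * (- (g * a%:R) * y + y * (g * a%:R)) = 0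
    & delta^-1 * (- (g * a%:R) * (g * b%:R) + y * x) = 1].
    by split; rewrite /delta; field.
  by rewrite raddf0 -scalar_mx_block.
have [Qu _] := mulmx1_unit QZ.
have invQ : invmx Q = Z by rewrite -[LHS]mulmx1 -QZ mulKmx.
have detQ : \det Q = delta.
  rewrite /Q det_Schur_ul ?unitmxE ?det_scalar1 ?unitfE //.
  rewrite invmx_scalar -!raddfN /= -!scalar_mxM -raddfN /= -scalar_mxM -raddfD /= det_scalar1 /delta.
  by field.
(* The row (g a / 2, g b / 2) times the inverse of [Q] times the column (g t, g t). *)
pose k := g ^+ 2 * t * sigma / (2 * delta).
have -> : \det reduced_pencil = delta * \det (qL - (k * (nu - alpha * t - t)) *: const_mx 1).
  rewrite /reduced_pencil det_Schur_dr // -/Q invQ detQ; congr (_ * _).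
  have -> : block_mx 0 0 (const_mx (- (g / 2 * a%:R))) (const_mx (- (g / 2 * b%:R))) *m Z *m
     block_mx 0 (const_mx (- (g * t))) 0 (const_mx (- (g * t))) =
     block_mx 0 0 0 (k *: const_mx 1) :> 'M_(n + n).
    rewrite /Z -scalemxAr -!const_mx11 mulmx_block !(mul0mx, addr0).
    rewrite -scalemxAl mulmx_block !(mulmx0, mul0mx, addr0) !mul_const_mx.
    rewrite !mulmxDl !mul_const_mx scale_block_mx !scaler0; congr block_mx.
    by apply/matrixP => i j; rewrite !mxE /k /sigma; field.
  rewrite opp_block_mx add_block_mx !(oppr0, addr0) det_Schur_ul //.
  (* Absorbing the determinant of [S] into the Schur complement cancels [invmx S] and leaves a
     polynomial in L and J. *)
  rewrite -det_mulmx; congr (\det _).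
  rewrite mulmxBr mulmxDr mulmxN -scalemxAr.
  have -> : S *m (- g%:M *m invmx S *m - (L + w%:M)) = g *: (L + w%:M).
    rewrite -raddfN /= mul_scalar_mx scaleNr mulNmx !mulmxN !opprK -scalemxAl -scalemxAr.
    by rewrite mulmxA mulmxV // mul1mx.
  have LJ : L *m const_mx 1 = t *: const_mx 1 :> 'M_n.
    have -> : const_mx 1 = (const_mx 1 : 'cV_n) *m (const_mx 1 : 'rV_n) :> 'M[F]_n.
      by rewrite mul_const_mx !mulr1.
    by rewrite mulmxA L1 scalemxAl.
  rewrite /qL /S !(mulmxBr, mulmxBl, mulmxDr, mulmxDl) LJ !mul_scalar_mx !mul_mx_scalar.
  move: (L *m L) (const_mx 1) => L2 J; apply/matrixP => i j.
  rewrite !mxE /quad_c1 /quad_c0; case: eqP => _; rewrite ?mulr1n ?mulr0n; ring.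
rewrite -[LHS]mulrA det_sub_const //; first by rewrite mulrCA; congr (_ * _); rewrite /k; field.
rewrite /qL !mulmxDl -mulmxA L1 -scalemxAr L1 -scalemxAl L1 mul_scalar_mx.
by rewrite !scalerA -!scalerDl.
Qed.

End BlockDeterminant.

(** * Edges of a graph *)

Section EdgeCounting.
Variable G : sgraph.
Implicit Types (x y : G) (e f : edge G).

Lemma degreeE (H : sgraph) (x : H) : degree x = (\sum_y adj x y)%N.
Proof. by rewrite /degree cardsE -sum1_card big_mkcond. Qed.

Lemma cardsI_sum (T : finType) (A B : {set T}) :
  #|A :&: B| = (\sum_z (z \in A) * (z \in B))%N.
Proof.
rewrite -sum1_card big_mkcond; apply: eq_bigr => z _.
by rewrite inE; do 2!case: (_ \in _).
Qed.

Lemma edgesP (A : {set G}) :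
  reflect (exists x y, adj x y /\ A = [set x; y]) (A \in edges G).
Proof.
apply: (iffP imsetP) => [[[x y]]|[x [y [xy ->]]]]; last by exists (x, y); rewrite ?inE.
by rewrite inE /= => xy ->; exists x, y.
Qed.

Lemma adj_neq x y : adj x y -> x != y.
Proof. by apply: contraTneq => ->; rewrite adj_irrefl. Qed.

Lemma mem_edges2 x y : x != y -> ([set x; y] \in edges G) = adj x y.
Proof.
move=> xy; apply/edgesP/idP => [[u [v [uv e]]]|xy']; last by exists x, y.
have : x \in [set u; v] by rewrite -e set21.
have : y \in [set u; v] by rewrite -e set22.
rewrite !inE => /orP[] /eqP yE /orP[] /eqP xE; move: xy; rewrite yE xE ?eqxx //.
by rewrite adj_sym.
Qed.

Lemma card_edge e : #|val e| = 2%N.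
Proof. by have /edgesP[x [y [/adj_neq xy ->]]] := valP e; rewrite cards2 xy. Qed.

Lemma edge_eq_set2 e x y : x != y -> x \in val e -> y \in val e -> val e = [set x; y].
Proof.
move=> xy xe ye; apply/esym/eqP; rewrite eqEcard card_edge cards2 xy andbT.
by apply/subsetP => z; rewrite !inE => /orP[] /eqP ->.
Qed.

(** Two common vertices determine an edge, so distinct edges share at most one. These are the
    entries of B^T B. *)
Lemma card_edgeI e f :
  #|val e :&: val f| = if e == f then 2%N else (val e :&: val f != set0) : nat.
Proof.
case: eqP => [->|/eqP ef]; first by rewrite setIid card_edge.
rewrite -card_gt0; case: ltngtP (leqnn 1) => // _ _.
case: (ltnP 1 #|val e :&: val f|) => [/card_gt1P[x [y []]]|].
  rewrite !inE => /andP[xe xf] /andP[ye yf] xy; case/eqP: ef; apply: val_inj.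
  by rewrite (edge_eq_set2 xy xe ye) (edge_eq_set2 xy xf yf).
by case: #|_| => [|[]].
Qed.

Lemma sum_edges_mem2 x y : x != y ->
  (\sum_(e : edge G) (x \in val e) * (y \in val e) = adj x y)%N.
Proof.
move=> xy; case: (boolP (adj x y)) => [a|na].
  have m2 : [set x; y] \in edges G by rewrite mem_edges2.
  pose e0 : edge G := Sub [set x; y] m2.
  rewrite (bigD1 e0) //= set21 set22 big1 // => e /eqP ne.
  case: (boolP (x \in val e)) => // xe; case: (boolP (y \in val e)) => // ye.
  by case: ne; apply: val_inj; rewrite (edge_eq_set2 xy xe ye).
rewrite big1 // => e _; case: (boolP (x \in val e)) => // xe.
case: (boolP (y \in val e)) => // ye.
by move: (valP e) na; rewrite (edge_eq_set2 xy xe ye) mem_edges2 // => ->.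
Qed.

Lemma sum_mem_edge e : (\sum_x (x \in val e) = 2)%N.
Proof. by rewrite -(card_edge e) -sum1_card [RHS]big_mkcond. Qed.

(** Each edge at [x] has exactly one other end; the count is then exchanged to run over that end. *)
Lemma sum_edges_mem x : (\sum_(e : edge G) (x \in val e) = degree x)%N.
Proof.
have e2 (e : edge G) : ((x \in val e) = \sum_(y | y != x) (x \in val e) * (y \in val e) :> nat)%N.
  case: (boolP (x \in val e)) => xe; last by rewrite big1 // => *; rewrite mul0n.
  have := sum_mem_edge e; rewrite (bigD1 x) //= xe => -[c].
  by apply: etrans (esym c) _; apply: eq_bigr => y _; rewrite mul1n.
rewrite (eq_bigr _ (fun e _ => e2 e)) exchange_big /= degreeE [RHS](bigD1 x) //=.
rewrite adj_irrefl add0n; apply: eq_bigr => y yx.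
by rewrite sum_edges_mem2 // eq_sym.
Qed.

Lemma handshake t : regular G t -> (#|G| * t = 2 * #|edge G|)%N.
Proof.
move=> regG; have : (\sum_x \sum_(e : edge G) (x \in val e) = 2 * #|edge G|)%N.
  by rewrite exchange_big /= (eq_bigr _ (fun e _ => sum_mem_edge e)) sum_nat_const mulnC.
by rewrite (eq_bigr (fun=> t)) ?sum_nat_const // => x _; rewrite sum_edges_mem regG.
Qed.

Lemma card_edge_type : #|edge G| = #|edges G|.
Proof. by rewrite card_sig; apply: eq_card => A; rewrite inE. Qed.

(** The line graph is (2 t - 2)-regular, stated without truncated subtraction: the intersections of
    [e] with all edges have total size 2 t, of which [e] itself accounts for 2. *)
Lemma sum_adj_edge t e : regular G t ->
  (\sum_(f : edge G) (e != f) && (val e :&: val f != set0) + 2 = 2 * t)%N.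
Proof.
move=> regG; have : (\sum_(f : edge G) #|val e :&: val f| = 2 * t)%N.
  rewrite (eq_bigr _ (fun f _ => cardsI_sum _ _)) exchange_big /=.
  rewrite (eq_bigr (fun x => (x \in val e) * t)%N); last first.
    by move=> x _; rewrite -big_distrr /= sum_edges_mem regG.
  by rewrite -big_distrl /= sum_mem_edge.
move=> <-; rewrite [in LHS](bigD1 e) //= eqxx /= add0n [RHS](bigD1 e) //= setIid card_edge.
rewrite addnC; congr addn; apply: eq_bigr => f fe.
by rewrite card_edgeI eq_sym (negbTE fe).
Qed.

End EdgeCounting.

(** * The A_alpha-matrix of the join *)

Section JoinMatrix.
Variables (R : rcfType) (alpha : R) (G : sgraph) (t a b : nat).
Hypothesis regG : regular G t.

Let J := T_edge_join G (complete_bipartite a b).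
Let n := #|G|.
Let m := #|edge G|.
Let g := 1 - alpha.
Let L : 'M[R]_n := A_alpha alpha G.
Let B : 'M[R]_(n, m) := fun_mx (fun x (e : edge G) => (x \in val e)%:R).

Lemma sum_nat_const1 (T : finType) : (\sum_(x : T) 1 = #|T|)%N.
Proof. by rewrite sum1_card. Qed.

Lemma degree_join_vertex (x : G) : @degree J (inl (inl x)) = (2 * t)%N.
Proof.
rewrite degreeE !big_sumType /= -degreeE regG sum_edges_mem regG.
by rewrite !big1 // !addn0 mul2n addnn.
Qed.

Lemma degree_join_edge (e : edge G) : @degree J (inl (inr e)) = (2 * t + (a + b))%N.
Proof.
rewrite degreeE !big_sumType /= sum_mem_edge !sum_nat_const1 !card_ord.
by rewrite (addnC 2) (sum_adj_edge e regG).
Qed.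

Lemma degree_join_left (i : 'I_a) : @degree J (inr (inl i)) = (m + b)%N.
Proof.
rewrite degreeE !big_sumType /= !sum_nat_const1 !card_ord !big1 //.
Qed.

Lemma degree_join_right (i : 'I_b) : @degree J (inr (inr i)) = (m + a)%N.
Proof.
by rewrite degreeE !big_sumType /= !sum_nat_const1 !card_ord !big1 // addn0.
Qed.

Lemma A_alphaE (H : sgraph) : A_alpha alpha H = fun_mx (fun x y : H =>
  alpha * (degree x)%:R *+ (x == y) + g * (adj x y)%:R).
Proof.
apply/matrixP => i j; rewrite !mxE (inj_eq enum_val_inj).
by case: eqP => [->|]; rewrite ?mulr1n ?mulr0n ?mulr0.
Qed.

Lemma A_alpha_sym (H : sgraph) : (A_alpha alpha H)^T = A_alpha alpha H.
Proof.
rewrite A_alphaE; apply/matrixP => i j; rewrite !mxE adj_sym eq_sym.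
by case: eqP => [->|].
Qed.

Lemma fun_mx_const (S T : finType) (f : S -> T -> R) c :
  (forall x, \sum_y f x y = c) -> fun_mx f *m (const_mx 1 : 'cV_#|T|) = c *: const_mx 1.
Proof.
move=> fc; apply/matrixP => i j; rewrite !mxE mulr1 -(fc (enum_val i)).
rewrite [RHS](reindex (@enum_val T T)) /=; last first.
  by exists enum_rank => z _; rewrite ?enum_rankK ?enum_valK.
by apply: eq_bigr => k _; rewrite !mxE mulr1.
Qed.

Lemma tr_fun_mx (S T : finType) (f : S -> T -> R) :
  (fun_mx f)^T = fun_mx (fun x y => f y x).
Proof. by apply/matrixP => i j; rewrite !mxE. Qed.

Lemma A_alpha_regular_const : L *m (const_mx 1 : 'cV_n) = t%:R *: const_mx 1.
Proof.
rewrite /L A_alphaE; apply: fun_mx_const => x; rewrite big_split /= -big_distrr /=.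
rewrite -natr_sum -degreeE (bigD1 x) //= eqxx big1 => [|y /negbTE]; last first.
  by rewrite eq_sym => ->.
by rewrite regG /g mulr1n; ring.
Qed.

Lemma incidence_const : B *m (const_mx 1 : 'cV_m) = t%:R *: const_mx 1.
Proof. by apply: fun_mx_const => x; rewrite -natr_sum sum_edges_mem regG. Qed.

Lemma incidence_tr_const : B^T *m (const_mx 1 : 'cV_n) = 2 *: const_mx 1.
Proof.
by rewrite /B tr_fun_mx; apply: fun_mx_const => e; rewrite -natr_sum sum_mem_edge.
Qed.

(** On the diagonal [g * t] splits into [alpha * t], coming from [L], and the scalar term. Off it,
    at most one edge contains both vertices. *)
Lemma incidence_gram :
  g *: (B *m B^T) = L + ((g - alpha) * t%:R)%:M.
Proof.
rewrite /L A_alphaE /B tr_fun_mx mul_fun_mx; apply/matrixP => i j; rewrite !mxE.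
under eq_bigr do rewrite -natrM.
rewrite -natr_sum -(inj_eq enum_val_inj); case: eqP => [->|/eqP ij].
  under eq_bigr do rewrite mulnb andbb; rewrite sum_edges_mem adj_irrefl regG !mulr1n.
  by rewrite /g /=; ring.
by rewrite sum_edges_mem2 // !mulr0n addr0 add0r.
Qed.

Lemma incidence_cogram : B^T *m B = fun_mx (fun e f : edge G =>
  2 *+ (e == f) + ((e != f) && (val e :&: val f != set0))%:R).
Proof.
rewrite /B tr_fun_mx mul_fun_mx; apply/matrixP => i j; rewrite !mxE.
under eq_bigr do rewrite -natrM.
rewrite -natr_sum -cardsI_sum card_edgeI.
by case: eqP => _; rewrite ?mulr1n ?mulr0n ?addr0 ?add0r.
Qed.

(** The line graph has adjacency matrix B^T B - 2, so the edge block has scalar part nu - alpha (2 t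
    + n2) + 2 (1 - alpha), which is the value given for Y. *)
Lemma det_join_A_alpha nu : \det (nu%:M - A_alpha alpha J) =
  \det (join_pencil a b L B alpha t%:R nu
    (nu - (alpha * (2 * t%:R + 2 + (a + b)%:R) - 2))
    (nu - alpha * (m%:R + b%:R)) (nu - alpha * (m%:R + a%:R))).
Proof.
pose F (x y : J) := (nu - alpha * (degree x)%:R) *+ (x == y) - g * (adj x y)%:R.
have -> : nu%:M - A_alpha alpha J = fun_mx F.
  rewrite A_alphaE; apply/matrixP => i j; rewrite !mxE /F (inj_eq enum_val_inj).
  by case: eqP => _; rewrite ?mulr1n ?mulr0n; ring.
have bij_id p : bijective (@id 'I_p) by exists id.
rewrite (det_fun_mx _ (ord_sum_bij
  (ord_sum_bij (@enum_val_bij G) (@enum_val_bij (edge G))) (ord_sum_bij (bij_id a) (bij_id b)))).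
rewrite (block_ord_sum _ _ _ _ F) /join_pencil; congr (\det (block_mx _ _ _ _)).
- rewrite (block_ord_sum _ _ _ _ (fun x y => F (inl x) (inl y))).
  rewrite incidence_cogram.
  congr block_mx; apply/matrixP => i j; rewrite ?mxE /F !(inj_eq inl_inj).
  + rewrite (inj_eq enum_val_inj) degree_join_vertex regG natrM /g /=.
    by case: eqP => _; rewrite ?mulr1n ?mulr0n; ring.
  + by rewrite sub0r mulNr.
  + by rewrite sub0r mulNr.
  + rewrite (inj_eq inr_inj) -(inj_eq enum_val_inj) degree_join_edge natrD natrM /g /=.
    by case: eqP => _ /=; rewrite ?mulr1n ?mulr0n; ring.
- rewrite (block_ord_sum _ _ _ _ (fun x y => F (inl x) (inr y))).
  by congr block_mx; apply/matrixP => i j; rewrite !mxE /F ?sub0r /= ?mulr1 // mulr0 oppr0.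
- rewrite (block_ord_sum _ _ _ _ (fun x y => F (inr x) (inl y))).
  by congr block_mx; apply/matrixP => i j; rewrite !mxE /F ?sub0r /= ?mulr1 // mulr0 oppr0.
- rewrite (block_ord_sum _ _ _ _ (fun x y => F (inr x) (inr y))).
  congr block_mx; apply/matrixP => i j; rewrite !mxE /F (inj_eq inr_inj).
  + by rewrite (inj_eq inl_inj) degree_join_left natrD /= mulr0 subr0.
  + by rewrite sub0r /= mulr1.
  + by rewrite sub0r /= mulr1.
  + by rewrite (inj_eq inr_inj) degree_join_right natrD /= mulr0 subr0.
Qed.

End JoinMatrix.

(** * The largest eigenvalue of a regular graph *)

Section RegularSpectrum.
Variables (R : rcfType) (alpha : R) (G : sgraph) (t : nat).
Hypotheses (alpha01 : 0 <= alpha <= 1) (regG : regular G t).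

Let L := A_alpha alpha G.

(* Compare the two sides of v L = z v at an entry of v of maximal absolute value. *)
Lemma regular_eigenvalue_le z : eigenvalue L z -> z <= t%:R.
Proof.
case/andP: alpha01 => alpha0 alpha1 /eigenvalueP[v vL v0].
have [i0 vi0] : exists i, v 0 i != 0.
  by apply/existsP; apply: contraR v0 => /existsPn v0; apply/eqP/rowP => i;
     rewrite mxE; apply/eqP; rewrite -[_ == _]negbK v0.
pose i := [arg max_(j > i0) `|v 0 j|]%O.
have vmax j : `|v 0 j| <= `|v 0 i|.
  by rewrite /i; case: arg_maxP => // k _; apply.
have vi : 0 < `|v 0 i| by apply: lt_le_trans (vmax i0); rewrite normr_gt0.
have L0 j k : 0 <= L j k.
  by rewrite /L A_alphaE mxE addr_ge0 ?mulrn_wge0 ?mulr_ge0 ?subr_ge0 //.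
have Lsym j k : L j k = L k j by rewrite /L -{1}A_alpha_sym mxE.
have colL : \sum_j L j i = t%:R.
  have /matrixP/(_ i 0) := A_alpha_regular_const alpha regG.
  rewrite -/L !mxE mulr1 => <-; apply: eq_bigr => j _.
  by rewrite [const_mx _ _ _]mxE mulr1 Lsym.
rewrite -(ler_pM2r vi); apply: le_trans (ler_norm _) _.
rewrite normrM normr_id -normrM.
have /rowP/(_ i) := vL; rewrite !mxE => <-.
apply: le_trans (ler_norm_sum _ _ _) _; rewrite -colL mulr_suml.
by apply: ler_sum => j _; rewrite normrM (ger0_norm (L0 _ _)) mulrC ler_wpM2l.
Qed.

(** The all-one vector makes t an eigenvalue, and t bounds all eigenvalues, so it heads the
    nonincreasing list. *)
Lemma regular_spectrum : (0 < #|G|)%N ->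
  spectrum L = t%:R :: [seq lambda i L | i <- index_iota 2 #|G|.+1].
Proof.
move=> n0; have [chL _] := sym_spectrum (A_alpha_sym alpha G).
have szL : size (spectrum L) = #|G|.
  by apply: succn_inj; rewrite -[LHS](size_prod_XsubC _ id) -chL size_char_poly.
have memL z : (z \in spectrum L) = eigenvalue L z.
  by rewrite eigenvalue_root_char -/L chL root_prod_XsubC.
have tL : t%:R \in spectrum L.
  rewrite memL; apply/eigenvalueP; exists (const_mx 1).
    have := congr1 trmx (A_alpha_regular_const alpha regG).
    by rewrite trmx_mul A_alpha_sym linearZ /= !trmx_const.
  apply/eqP => /rowP /(_ (Ordinal n0)); rewrite !mxE => /eqP.
  by rewrite oner_eq0.
have : sorted >=%R (spectrum L) by apply: sort_sorted => x y; apply: le_total.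
rewrite /lambda; case E: (spectrum L) szL tL => [|h r] //= szr tL hr.
have -> : h = t%:R.
  apply/eqP; rewrite eq_le regular_eigenvalue_le ?andTb; last first.
    by rewrite -memL E mem_head.
  move: tL; rewrite inE => /orP[/eqP -> //|tr].
  by have /allP/(_ _ tr) := order_path_min (@ge_trans _ _) hr.
(* [lambda i] reads position [i.-1], so the indices from 2 on list the tail [r]. *)
congr (_ :: _); rewrite -szr /index_iota subSS subn1 /=.
rewrite (iotaDl 2 0) -map_comp -[LHS](mkseq_nth 0) /mkseq.
exact: eq_map.
Qed.

End RegularSpectrum.

(** * The characteristic polynomial of the join *)

Section MonicPolynomials.
Variable R : rcfType.
Implicit Types (p q : {poly R}) (u v : R).

Lemma prod_XsubC_nseq k (z : R) :
  \prod_(x <- nseq k z) ('X - x%:P) = ('X - z%:P) ^+ k.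
Proof. by elim: k => [|k IHk]; rewrite ?big_nil //= big_cons IHk exprS. Qed.

Lemma size_deg2 u v : size ('X^2 - u *: 'X + v%:P) = 3%N.
Proof.
rewrite -addrA size_polyDl size_polyXn // (leq_ltn_trans (size_polyD _ _)) //.
rewrite gtn_max size_polyN (leq_ltn_trans (size_scale_leq _ _)) ?size_polyX //.
exact: leq_ltn_trans (size_polyC_leq1 _) _.
Qed.

Lemma monic_deg2 u v : 'X^2 - u *: 'X + v%:P \is monic.
Proof.
rewrite monicE -addrA lead_coefDl ?lead_coefXn // size_polyXn.
rewrite (leq_ltn_trans (size_polyD _ _)) // gtn_max size_polyN.
rewrite (leq_ltn_trans (size_scale_leq _ _)) ?size_polyX //.
exact: leq_ltn_trans (size_polyC_leq1 _) _.
Qed.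

Lemma quadratic_regularE (alpha t n2 l : R) : exists u v,
  quadratic_regular alpha t n2 l = 'X^2 - u *: 'X + v%:P.
Proof. by do 2!eexists; rewrite /quadratic_regular -!addrA -polyCN -polyCD. Qed.

Lemma monic_size_quadratic_regular (alpha t n2 l : R) :
  quadratic_regular alpha t n2 l \is monic /\ size (quadratic_regular alpha t n2 l) = 3%N.
Proof.
by have [u [v ->]] := quadratic_regularE alpha t n2 l; rewrite monic_deg2 size_deg2.
Qed.

(** The leading term comes from the product of two monic quadratics; the subtracted term has degree
    at most 2. *)
Lemma monic_size_quartic_regular (alpha t n m a b : R) :
  quartic_regular alpha t n m a b \is monic /\
  size (quartic_regular alpha t n m a b) = 5%N.
Proof.
rewrite /quartic_regular; set p := _ * _; set q := _ *: _.
have pm : p \is monic by rewrite /p monicMr ?monic_deg2.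
have sp : size p = 5%N by rewrite /p size_monicM ?monic_neq0 ?monic_deg2 // !size_deg2.
have sq : (size (- q) < size p)%N.
  rewrite sp size_polyN /q ltnS (leq_trans (size_scale_leq _ _)) //.
  rewrite (leq_trans (size_polyMleq _ _)) // size_XsubC /=.
  rewrite add1n (leq_ltn_trans (size_polyD _ _)) // gtn_max.
  rewrite (leq_ltn_trans (size_polyC_leq1 _)) // andbT.
  rewrite (leq_ltn_trans (size_polyD _ _)) // gtn_max size_polyN.
  rewrite (leq_ltn_trans (size_polyC_leq1 _)) // andbT.
  by rewrite (leq_ltn_trans (size_scale_leq _ _)) // size_XsubC.
by split; rewrite ?monicE ?lead_coefDl ?size_polyDl.
Qed.

End MonicPolynomials.

Section JoinCharPoly.
Variables (R : rcfType) (alpha : R) (G : sgraph) (t a b : nat).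
Hypotheses (alpha01 : 0 <= alpha <= 1) (regG : regular G t) (n0 : (0 < #|G|)%N).

Let n := #|G|.
Let m := #|edge G|.
Let L := A_alpha alpha G.
Let c : R := alpha * (2 * t%:R + 2 + (a + b)%:R) - 2.
Let ex : R := alpha * (m%:R + b%:R).
Let ey : R := alpha * (m%:R + a%:R).
Let quad z := quadratic_regular alpha t%:R (a + b)%:R z.
Let quartic := quartic_regular alpha t%:R n%:R m%:R a%:R b%:R.
Let chi := char_poly (A_alpha alpha (T_edge_join G (complete_bipartite a b))).

(* Multiplying by the factors on the left avoids the exponent m - n, which is -1
   for K_2, and lets the product run over the whole spectrum of A_alpha(G1). *)
Lemma char_poly_join_mul :
  chi * ('X - c%:P) ^+ n * ('X - ex%:P) * ('X - ey%:P) * quad t%:R =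
  ('X - c%:P) ^+ m * ('X - ex%:P) ^+ a * ('X - ey%:P) ^+ b *
    (\prod_(z <- spectrum L) quad z) * quartic.
Proof.
have [chL detL] := sym_spectrum (A_alpha_sym alpha G).
(* It suffices to compare values where everything to be inverted is invertible. *)
pose dlt : {poly R} := 'X^2 - (ex + ey) *: 'X + (ex * ey - (1 - alpha) ^+ 2 * a%:R * b%:R)%:P.
(* [dlt] takes the value [delta]; the shifted characteristic polynomial of [L] excludes a singular
   S, and the product of quadratics a singular q(L). *)
pose bad := 'X * ('X - c%:P) * ('X - ex%:P) * ('X - ey%:P) * dlt
   * (char_poly L \Po ('X - (alpha * t%:R)%:P)) * \prod_(z <- spectrum L) quad z.
have bad0 : bad != 0.
  rewrite /bad !mulf_neq0 ?polyX_eq0 ?polyXsubC_eq0 //.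
  - exact/monic_neq0/monic_deg2.
  - by rewrite comp_poly_eq0 ?size_XsubC // monic_neq0 ?char_poly_monic.
  - by apply/monic_neq0/monic_prod => z _; case: (monic_size_quadratic_regular alpha t%:R (a + b)%:R z).
apply: (poly_eq_off_roots bad0) => nu.
rewrite /bad !rootM !negb_or !root_XsubC /root horner_comp horner_prod /dlt.
rewrite !(hornerD, hornerN, hornerZ, hornerXn, hornerX, hornerC) -!andbA.
set ch := (char_poly L).[_]; set pq := \prod_(z <- _) (quad z).[nu].
case/and5P=> nu0 nuc nux nuy /and3P[dl0 ch0 pq0].
pose Y := nu - c; pose x := nu - ex; pose y := nu - ey.
pose q z := z ^+ 2 + quad_c1 alpha t%:R nu Y * z + quad_c0 alpha t%:R nu Y.
have quadE z : (quad z).[nu] = q z.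
  rewrite /quad /quadratic_regular !(hornerD, hornerN, hornerZ, hornerXn, hornerX, hornerC).
  by rewrite /q /quad_c1 /quad_c0 /Y /c; ring.
pose qL := L *m L + quad_c1 alpha t%:R nu Y *: L + (quad_c0 alpha t%:R nu Y)%:M.
have detqL : \det qL = pq.
  rewrite /qL -[L *m L]scale1r detL; apply: eq_bigr => z _.
  by rewrite quadE mul1r.
(* As t lies in the spectrum of [L], this is one of the factors of [pq]. *)
have qt0 : q t%:R != 0.
  apply: contraNneq pq0 => qt; rewrite /pq (regular_spectrum alpha01 regG n0).
  by rewrite big_cons quadE qt mul0r.
have hdet := det_join_A_alpha alpha a b regG nu.
have Y0 : Y != 0 by rewrite subr_eq0.
have x0 : x != 0 by rewrite subr_eq0.
have y0 : y != 0 by rewrite subr_eq0.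
have h1 := det_join_pencil a b (incidence_gram alpha regG) (incidence_const R regG) (incidence_tr_const R G)
  nu0 Y0 x0 y0.
have d0 : x * y - (1 - alpha) ^+ 2 * a%:R * b%:R != 0.
  by apply: contra_neq dl0 => e; rewrite -[RHS]e /x /y; ring.
have Su : nu%:M - (alpha * t%:R)%:M - L \in unitmx.
  by rewrite unitmxE unitfE -raddfB -horner_char_poly.
have qLu : qL \in unitmx by rewrite unitmxE unitfE detqL.
have /= := det_reduced_pencil (A_alpha_regular_const alpha regG) x0 d0 Su qLu qt0.
rewrite -/qL detqL -/(q t%:R).
move=> h2; rewrite !(hornerM, horner_exp, hornerXsubC) horner_prod.
rewrite -/pq quadE /chi horner_char_poly hdet -/m.
rewrite -/ex -/ey -/c -/Y -/x -/y.
(* The quadratic factors of the quartic are q(t) and [delta], and its last bracket is [sigma]. *)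
have -> : (quartic).[nu] = q t%:R * (x * y - (1 - alpha) ^+ 2 * a%:R * b%:R)
  - 2^-1 * t%:R * n%:R * (1 - alpha) ^+ 2 * (nu - (t%:R + alpha * t%:R))
    * (a%:R * y + b%:R * x + 2 * (1 - alpha) * a%:R * b%:R).
  rewrite /quartic /quartic_regular.
  rewrite !(hornerD, hornerN, hornerZ, hornerM, hornerXn, hornerX, hornerC).
  by rewrite /q /quad_c1 /quad_c0 /x /y /Y /c /ex /ey !natrD; ring.
by rewrite -[RHS]mulrA /n -h2 [RHS]mulrA -h1 !mulrA.
Qed.

Let rest := index_iota 2 n.+1.

(** The first eigenvalue t contributes [quad t%:R], which cancels together with one linear factor
    for each part of K_{a,b}. *)
Lemma char_poly_join : (0 < a)%N -> (0 < b)%N ->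
  chi * ('X - c%:P) ^+ n =
  ('X - c%:P) ^+ m * ('X - ex%:P) ^+ (a - 1) * ('X - ey%:P) ^+ (b - 1) *
    (\prod_(i <- rest) quad (lambda i L)) * quartic.
Proof.
move=> a0 b0; have := char_poly_join_mul.
rewrite (regular_spectrum alpha01 regG n0) big_cons big_map -/rest.
rewrite -{1}(subnK a0) -{1}(subnK b0) !exprD !expr1 => e.
have q0 : quad t%:R != 0.
  by apply: monic_neq0; case: (monic_size_quadratic_regular alpha t%:R (a + b)%:R t%:R).
apply: (mulIf q0); apply: (mulIf (monic_neq0 (monicXsubC ey))).
apply: (mulIf (monic_neq0 (monicXsubC ex))).
transitivity (chi * ('X - c%:P) ^+ n * ('X - ex%:P) * ('X - ey%:P) * quad t%:R).
  by move: (quad _) (chi) => ? ?; ring.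
rewrite e; move: ('X - ex%:P) ('X - ey%:P) (_ ^+ m) (_ ^+ (a - 1)) (_ ^+ (b - 1)).
move: (quad _) quartic (\prod_(i <- _) _) => *; ring.
Qed.

(* The characteristic polynomial of a symmetric matrix splits, hence so do the
   quadratic and quartic factors. *)
Lemma split_dvd_char_poly_join p : (0 < a)%N -> (0 < b)%N -> p \is monic ->
  p %| (\prod_(i <- rest) quad (lambda i L)) * quartic ->
  p = \prod_(z <- solutions p) ('X - z%:P).
Proof.
move=> a0 b0 pm pq.
(* The roots of the left side of [char_poly_join]: the spectrum of the join and n copies of [c]. *)
apply: (@monic_dvd_split _ p (spectrum (A_alpha alpha (T_edge_join G (complete_bipartite a b))) ++ nseq n c)) => //.
have [chJ _] := sym_spectrum (A_alpha_sym alpha (T_edge_join G (complete_bipartite a b))).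
rewrite big_cat /= -chJ prod_XsubC_nseq -/chi char_poly_join // -mulrA.
exact: dvdp_mull.
Qed.

Lemma join_solutions : (0 < a)%N -> (0 < b)%N ->
  (forall i, (2 <= i <= n)%N ->
     quad (lambda i L) = \prod_(z <- solutions (quad (lambda i L))) ('X - z%:P)) /\
  quartic = \prod_(z <- solutions quartic) ('X - z%:P).
Proof.
move=> a0 b0; split=> [i i2n|]; apply: split_dvd_char_poly_join => //.
- by case: (monic_size_quadratic_regular alpha t%:R (a + b)%:R (lambda i L)).
- rewrite dvdp_mulr // (big_rem i) ?dvdp_mulIl //= mem_index_iota.
  by rewrite ltnS.
- by case: (monic_size_quartic_regular alpha t%:R n%:R m%:R a%:R b%:R).
- exact: dvdp_mulIr.
Qed.

End JoinCharPoly.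

(** * The case of K_2 and the two spectra *)

(** A vertex and its unique neighbour form a set closed under adjacency, hence the whole graph by
    connectedness. *)
Lemma cards_connected_1regular (G : sgraph) :
  (0 < #|G|)%N -> connected G -> regular G 1 -> #|G| = 2%N.
Proof.
case/card_gt0P => x _ conG regG.
have nbr u v w : adj u v -> adj u w -> v = w :> G.
  have /eqP/cards1P[z uz] := regG u; move=> uv uw.
  have : v \in [set z] by rewrite -uz inE.
  have : w \in [set z] by rewrite -uz inE.
  by rewrite !inE => /eqP -> /eqP ->.
have /eqP/cards1P[y xyE] := regG x.
have xy : adj x y by have := set11 y; rewrite -xyE inE.
have clo : closed (@adj G) [set x; y].
  apply: intro_closed => [|u v uv]; first exact/sym_connect_sym/adj_sym.
  rewrite !inE => /orP[] /eqP eu; subst u; apply/orP.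
    by right; apply/eqP; apply: nbr uv xy.
  by left; apply/eqP; apply: nbr uv _; rewrite adj_sym.
suff /eq_card -> : G =i [set x; y] by rewrite cards2 adj_neq.
by move=> z; rewrite -(closed_connect clo (conG x z)) set21.
Qed.

Lemma quartic_K2E (R : rcfType) (alpha a b : R) :
  quartic_K2 alpha a b = quartic_regular alpha 1 2 1 a b.
Proof.
rewrite /quartic_K2 /quartic_regular; apply: (poly_eq_off_roots (oner_neq0 _)) => z _.
by rewrite !(hornerD, hornerN, hornerZ, hornerM, hornerXn, hornerX, hornerC); field.
Qed.

(** At the second eigenvalue of K_2 the quadratic contains the linear factor that compensates the
    exponent m - n = -1; the other factor gives the simple eigenvalue. *)
Lemma quadratic_K2E (R : rcfType) (alpha n2 : R) :
  quadratic_regular alpha 1 n2 (2 * alpha - 1) =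
  ('X - (alpha * (2 * 1 + 2 + n2) - 2)%:P) * ('X - (3 * alpha - 1)%:P).
Proof.
rewrite /quadratic_regular; apply: (poly_eq_off_roots (oner_neq0 _)) => z _.
by rewrite !(hornerD, hornerN, hornerZ, hornerM, hornerXn, hornerX, hornerC); ring.
Qed.

(** The trace is 2 alpha and the first eigenvalue is 1. *)
Lemma lambda2_K2 (R : rcfType) (alpha : R) (G : sgraph) :
  0 <= alpha <= 1 -> #|G| = 2%N -> regular G 1 ->
  lambda 2 (A_alpha alpha G) = 2 * alpha - 1.
Proof.
move=> alpha01 G2 regG.
have [chL _] := sym_spectrum (A_alpha_sym alpha G).
have n0 : (0 < #|G|)%N by rewrite G2.
have trL : \tr (A_alpha alpha G) = 2 * alpha.
  rewrite /mxtrace (eq_bigr (fun=> alpha)) ?sumr_const ?card_ord ?G2 ?mulr_natl // => i _.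
  by rewrite A_alphaE mxE eqxx adj_irrefl regG mulr1 mulr0 addr0.
have := char_poly_trace (A_alpha alpha G) n0; rewrite trL chL.
rewrite (regular_spectrum alpha01 regG n0); set s := _ :: _ => e.
have ss : s = [:: 1; lambda 2 (A_alpha alpha G)].
  by rewrite /s; have -> : index_iota 2 #|G|.+1 = [:: 2%N] by rewrite G2.
have := @coefPn_prod_XsubC R s; rewrite {1 3}ss /= => /(_ isT).
have -> : (\prod_(p <- s) ('X - p%:P))`_1 = - (2 * alpha) by rewrite -e G2.
by rewrite ss !big_cons big_nil addr0 => /oppr_inj ->; ring.
Qed.

Theorem corollary6p2 (R : rcfType) (alpha : R) (G1 : sgraph)
    (t1 n1 m1 a b n2 : nat) :
  0 <= alpha <= 1 ->
  (0 < n1)%N -> #|G1| = n1 -> #|edges G1| = m1 -> regular G1 t1 ->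
  (0 < a)%N -> (0 < b)%N -> n2 = (a + b)%N ->
  let S := spectrum (A_alpha alpha (T_edge_join G1 (complete_bipartite a b))) in
  (t1 = 1%N -> connected G1 ->
    let q := quartic_K2 alpha a%:R b%:R in
    size (solutions q) = 4%N /\
    perm_eq S
      ([:: 3 * alpha - 1]
       ++ nseq (b - 1) (alpha * (1 + a%:R))
       ++ nseq (a - 1) (alpha * (1 + b%:R))
       ++ solutions q))
  /\
  ((2 <= t1)%N ->
    let quad i :=
      quadratic_regular alpha t1%:R n2%:R (lambda i (A_alpha alpha G1)) in
    let q := quartic_regular alpha t1%:R n1%:R m1%:R a%:R b%:R in
    [/\ (n1 <= m1)%N,
        forall i, (2 <= i <= n1)%N -> size (solutions (quad i)) = 2%N,
        size (solutions q) = 4%N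
      & perm_eq S
          (nseq (m1 - n1) (alpha * (2 * t1%:R + 2 + n2%:R) - 2)
           ++ nseq (b - 1) (alpha * (m1%:R + a%:R))
           ++ nseq (a - 1) (alpha * (m1%:R + b%:R))
           ++ flatten [seq solutions (quad i) | i <- index_iota 2 n1.+1]
           ++ solutions q)]).
Proof.
move=> alpha01 n0 n1E <- regG a0 b0 -> S; subst n1.
have hs := handshake regG.
have [quadS quarticS] := join_solutions alpha01 regG n0 a0 b0.
have chiE := char_poly_join alpha01 regG n0 a0 b0.
have [chiS _] := sym_spectrum (A_alpha_sym alpha (T_edge_join G1 (complete_bipartite a b))).
rewrite chiS -/S {chiS} in chiE; rewrite -!card_edge_type.
split=> [t1E conG q|t2 quad q].
- subst t1; have G2 := cards_connected_1regular n0 conG regG.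
  have em1 : #|edge G1| = 1%N by move: hs; rewrite G2; lia.
  have lam := lambda2_K2 alpha01 G2 regG.
  have exp2 (p : {poly R}) : p ^+ #|G1| = p ^+ 2 by rewrite G2.
  have rest2 : index_iota 2 #|G1|.+1 = [:: 2%N] by rewrite G2.
  move: chiE quarticS; rewrite exp2 rest2 big_seq1 lam quadratic_K2E G2 em1.
  rewrite -quartic_K2E -/q => e qS; split.
    rewrite (size_solutions qS) /q quartic_K2E.
    by case: (monic_size_quartic_regular alpha 1 2 1 a%:R b%:R) => _ ->.
  apply: prod_XsubC_eq; rewrite !big_cat big_seq1 !prod_XsubC_nseq /= -qS.
  (* Of the two copies of this factor to cancel, one comes from m = 1 and one from the quadratic. *)
  have c0 := monic_neq0 (monicXsubC (alpha * (2 * 1 + 2 + (a + b)%:R) - 2)).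
  apply: (mulIf (expf_neq0 2 c0)); rewrite e.
  move: {e qS} q ('X - (3 * alpha - 1)%:P) ('X - (_ - 2)%:P) (_ ^+ (a - 1)) (_ ^+ (b - 1)) => *.
  ring.
split.
(* From n t = 2 m and t >= 2. *)
- by move: hs t2; nia.
- move=> i i2n; rewrite size_solutions; last exact: quadS.
  by case: (monic_size_quadratic_regular alpha t1%:R (a + b)%:R (lambda i (A_alpha alpha G1))) => _ ->.
- rewrite size_solutions; last exact: quarticS.
  by case: (monic_size_quartic_regular alpha t1%:R #|G1|%:R #|edge G1|%:R a%:R b%:R) => _ ->.
(* Products of linear factors determine their roots up to order, so it remains to compare
   polynomials. *)
apply: prod_XsubC_eq; rewrite !big_cat /= !prod_XsubC_nseq big_flatten big_map /=.
rewrite -quarticS.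
rewrite -(eq_big_nat _ _ (F1 := quad)); last by move=> i i2n; apply: quadS.
have nm : (#|G1| <= #|edge G1|)%N by move: hs t2; nia.
have c0 := monic_neq0 (monicXsubC (alpha * (2 * t1%:R + 2 + (a + b)%:R) - 2)).
apply: (mulIf (expf_neq0 #|G1| c0)); rewrite chiE -{1}(subnK nm) exprD.
move: (quartic_regular _ _ _ _ _ _) (\prod_(_ <- _) _) => Q P.
move: (_ ^+ #|G1|) (_ ^+ (_ - #|G1|)) (_ ^+ (a - 1)) (_ ^+ (b - 1)) => *.
ring.
Qed.
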